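(* As $k\to\infty$, $f(k)=\frac{k^2}{3}\bigl(1+o(1)\bigr)$.
   Context: A $k$-colouring of the edges of the complete graph $K_n$ (colours from $[k]=\{1,\dots,k\}$) is called connected if for each colour $i\in[k]$ the edges of colour $i$ form a connected spanning subgraph of $K_n$. A triangle is multicoloured if its three edges have three distinct colours; its colour set is the set of these three colours. $f(k)$ denotes the minimum, over all $n$ and all connected $k$-colourings of $K_n$, of the number of distinct $3$-sets of colours that occur as colour sets of multicoloured triangles. *)

(* Defs.v *)
From mathcomp Require Import all_boot all_order all_algebra.
From Stdlib Require Import ClassicalEpsilon.
Set Implicit Arguments. Unset Strict Implicit. Unset Printing Implicit Defensive.

(* An edge colouring of K_n with colours 'I_k: a symmetric function on pairs of
   vertices; values on the diagonal are irrelevant. *)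
Definition sym_colouring (n k : nat) (c : 'I_n -> 'I_n -> 'I_k) : Prop :=
  forall x y : 'I_n, x != y -> c x y = c y x.

Definition colour_rel (n k : nat) (c : 'I_n -> 'I_n -> 'I_k) (i : 'I_k) : rel 'I_n :=
  fun a b => (a != b) && (c a b == i).

Definition connected_colouring (n k : nat) (c : 'I_n -> 'I_n -> 'I_k) : Prop :=
  sym_colouring c /\
  forall (i : 'I_k) (x y : 'I_n), connect (colour_rel c i) x y.

Definition triangle_colour_sets (n k : nat) (c : 'I_n -> 'I_n -> 'I_k)
  : {set {set 'I_k}} :=
  [set S : {set 'I_k} | [exists x : 'I_n, exists y : 'I_n, exists z : 'I_n,
     [&& x != y, y != z, x != z, #|[set c x y; c y z; c x z]| == 3 &
         S == [set c x y; c y z; c x z]]]].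

Definition achievable (k m : nat) : Prop :=
  exists (n : nat) (c : 'I_n -> 'I_n -> 'I_k),
    2 <= n /\ connected_colouring c /\ #|triangle_colour_sets c| = m.

Definition achievableb (k m : nat) : bool :=
  if excluded_middle_informative (achievable k m) then true else false.

Lemma achievableP k m : reflect (achievable k m) (achievableb k m).
Proof. by rewrite /achievableb; case: excluded_middle_informative => h; constructor. Qed.

(* f(k) = minimum achievable value (0 by convention if none exists) *)
Definition f (k : nat) : nat :=
  match excluded_middle_informative (exists m, achievableb k m) with
  | left H => ex_minn H
  | right _ => 0
  end.

(* Main.v *)
(* Lower bound: a 3-colouring of K_n with all three colours connected has a
   multicoloured triangle (Gallai).  Fixing a colour v and merging the other
   colours into two classes, this says that the link of v, i.e. the graph of
   the pairs {a, b} for which {v, a, b} is a colour set, is connected on k - 1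
   colours, hence has at least k - 2 edges.  Summing over v gives
   3 f(k) >= k (k - 2).

   Upper bound: on Z_N, N odd, give xy a colour depending only on +-(x - y).
   A colour is connected as soon as it contains a generator of Z_N, and a colour
   set arises from at least 12 pairs (d, e) (the ordered pairs among d, e,
   -(d + e), up to a global sign), so there are at most N^2 / 12 colour sets.
   If N = p^a q^b with p, q large primes, almost all differences are generators,
   so that k can be taken close to N / 2, and the integers p^a q^b are
   multiplicatively dense. *)
Require Import Defs.
From mathcomp Require Import all_boot all_order all_algebra.
From mathcomp Require Import zify lra.
From Stdlib Require Import ClassicalEpsilon.
Import Order.TTheory GRing.Theory Num.Theory.
Set Implicit Arguments. Unset Strict Implicit. Unset Printing Implicit Defensive.

(** * Gallai's theorem for three connected colours *)

Lemma ord3P (j : 'I_3) : [\/ j = 0%R, j = 1%R | j = 2%R].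
Proof.
by case: j => [[|[|[|]]]] // ?;
  [constructor 1 | constructor 2 | constructor 3]; apply: val_inj.
Qed.

Lemma ord3_others (i : 'I_3) : exists j l : 'I_3, [/\ j != i, l != i & j != l].
Proof.
case: i => [[|[|[|]]]] // ?.
- by exists 1%R, 2%R.
- by exists 0%R, 2%R.
- by exists 0%R, 1%R.
Qed.

Section Gallai.
Variables (T : finType) (c : T -> T -> 'I_3).
Hypothesis c_sym : forall x y, x != y -> c x y = c y x.

(** Kept as a relation on all of [T], so that the induction in [gallai] can shrink [V] without
    changing the type. *)
Definition mono (V : {set T}) (i : 'I_3) : rel T :=
  fun a b => [&& a \in V, b \in V, a != b & c a b == i].

Lemma mono_sym V i : connect_sym (mono V i).
Proof.
apply: sym_connect_sym => a b; rewrite /mono [b == a]eq_sym.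
case: eqVneq => [->|ne] /=; first by rewrite !andbF.
by rewrite (c_sym ne) andbCA.
Qed.

Lemma mono_closed V i : closed (mono V i) (mem V).
Proof. by move=> a b /and4P[aV bV _ _]; rewrite aV bV. Qed.

(** By induction on [#|V|], a colouring without multicoloured triangle leaves some colour
    disconnected on [V]. Otherwise delete a vertex [v]: a colour [i] disconnects the rest, and the
    edges from [v] in the other two colours clash across the components of colour [i]. *)
Lemma gallai (V : {set T}) :
  1 < #|V| ->
  (forall i, {in V &, forall x y, connect (mono V i) x y}) ->
  exists x y z, [/\ x != y, y != z & x != z] /\
    [/\ c x y != c y z, c y z != c x z & c x y != c x z].
Proof.
move=> V2 conV.
case: (boolP [exists x, exists y, exists z,
   [&& x != y, y != z, x != z, c x y != c y z, c y z != c x z & c x y != c x z]]).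
  by case/existsP=> x /existsP[y /existsP[z /and5P[? ? ? ? /andP[]]]]; exists x, y, z.
move=> noR.
have {noR} rb x y z : x != y -> y != z -> x != z ->
    c x y != c x z -> c x y = c y z \/ c x z = c y z.
  move=> xy yz xz ne; move: noR; rewrite negb_exists => /forallP/(_ x).
  rewrite negb_exists => /forallP/(_ y); rewrite negb_exists => /forallP/(_ z).
  rewrite xy yz xz ne /= andbT.
  by case: (c x y =P c y z); [left | case: (c y z =P c x z) => //; right].
suff: exists i, exists2 x, x \in V & exists2 y, y \in V &
        ~~ connect (mono V i) x y.
  by case=> i [x xV [y yV]]; rewrite conV.
move: V2; have [m] := ubnP #|V|; elim: m V {conV} => // m IH V Vm V2.
case: (boolP [exists i, exists x, exists y,
   [&& x \in V, y \in V & ~~ connect (mono V i) x y]]).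
  by case/existsP=> i /existsP[x /existsP[y /and3P[xV yV nc]]]; exists i;
     exists x => //; exists y.
move=> noD.
have {noD} con i x y : x \in V -> y \in V -> connect (mono V i) x y.
  move=> xV yV; move: noD; rewrite negb_exists => /forallP/(_ i).
  rewrite negb_exists => /forallP/(_ x); rewrite negb_exists => /forallP/(_ y).
  by rewrite xV yV /= negbK.
have /card_gt0P[v vV] : 0 < #|V| by lia.
set W := V :\ v.
have WV : #|V| = #|W|.+1 by rewrite (cardsD1 v) vV.
have nbr j : exists2 x, x \in W & c v x = j.
  have /card_gt0P[y] : 0 < #|W| by lia.
  rewrite !inE => /andP[yv yV].
  have /connectP[[|x p] /=] := con j v y vV yV.
    by move=> _ yE; rewrite yE eqxx in yv.
  case/andP=> /and4P[_ xV vx /eqP cj] _ _; exists x => //.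
  by rewrite !inE xV eq_sym vx.
(* A single remaining vertex cannot be joined to [v] in two colours. *)
have [W1|W2] := leqP #|W| 1.
  have [x xW cx] := nbr ord0; have [y yW cy] := nbr ord_max.
  have xy : x = y by apply: (card_le1_eqP W1).
  by rewrite xy cy in cx.
have [|i [a aW [b bW nab]]] := IH W _ W2; first by lia.
pose C := connect (mono W i).
have Csym : symmetric C by exact: mono_sym.
have Ctr : transitive C by exact: connect_trans.
have CW x y : C x y -> x \in W -> y \in W.
  by move=> xy; rewrite (closed_connect (@mono_closed W i) xy).
have cut x y : x \in W -> y \in W -> ~~ C x y -> x != y /\ c x y != i.
  move=> xW yW nxy; have ne : x != y by apply: contraNneq nxy => ->; exact: connect0.
  split=> //; apply: contra nxy => /eqP cxy; apply: connect1.
  by rewrite /mono xW yW ne cxy eqxx.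
(* Edges of colour i join x to x' in steps whose third vertex y sees other colours only. *)
have unif x x' y : x \in W -> y \in W -> C x x' -> ~~ C x y -> c x y = c x' y.
  move=> xW yW /connectP[p]; elim: p x xW => [|z p IHp] x xW /=; first by move=> _ ->.
  case/andP=> xz pz lz nxy.
  have Cxz : C x z by exact: connect1.
  have zW : z \in W by exact: CW Cxz xW.
  have nzy : ~~ C z y by apply: contra nxy; exact: Ctr.
  rewrite -(IHp z) //.
  have [xy cxy] := cut x y xW yW nxy; have [zy czy] := cut z y zW yW nzy.
  case/and4P: xz => _ _ xz /eqP cxz.
  case: (rb x y z) => //; first by rewrite eq_sym.
  - by rewrite cxz.
  - by rewrite (c_sym zy).
  - by rewrite cxz -(c_sym zy) => ciz; rewrite -ciz eqxx in czy.
(* Otherwise the component of x in V \ v would be a component of V. *)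
have att x : x \in W -> exists2 w, C x w & c v w = i.
  move=> xW; case: (boolP [exists w, C x w && (c v w == i)]).
    by case/existsP=> w /andP[xw /eqP cw]; exists w.
  rewrite negb_exists => /forallP no.
  have clo : closed (mono V i) (C x).
    apply: (intro_closed (@mono_sym V i)) => w z /and4P[_ zV wz cwz] xw.
    have wW : w \in W := CW _ _ xw xW.
    have zv : z != v.
      apply: contraTneq cwz => zv; rewrite zv in wz *.
      by rewrite (c_sym wz); move: (no w); rewrite [C x w]xw.
    have zW : z \in W by rewrite !inE zv.
    by apply: (Ctr _ _ _ xw); apply: connect1; rewrite /mono wW zW wz.
  have xV : x \in V by move: xW; rewrite inE => /andP[].
  have := closed_connect clo (con i x v xV vV).
  rewrite [x \in C x]connect0 => /esym xv; have := CW x v xv xW.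
  by rewrite !inE eqxx.
have vW x : x \in W -> v != x by rewrite !inE eq_sym => /andP[].
(* Apply rb to v, x and an i-neighbour w of v in the component of z. *)
have main x z : x \in W -> z \in W -> c v x != i -> ~~ C x z -> c x z = c v x.
  move=> xW zW cvx nxz; have [w zw cw] := att z zW.
  have wW : w \in W := CW _ _ zw zW.
  have nxw : ~~ C x w by apply: contra nxz => xw; rewrite Csym in zw; exact: Ctr xw zw.
  have [xz cxz] := cut _ _ xW zW nxz; have [xw cxw] := cut _ _ xW wW nxw.
  have ez : c x z = c x w.
    by rewrite (c_sym xz) (c_sym xw); apply: unif => //; rewrite Csym.
  case: (rb v x w) => //; rewrite ?vW // ?cw ?ez // => ciw.
  by rewrite ciw eqxx in cxw.
(* Take neighbours [x], [y] of [v] in the two colours other than [i]. In different components,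
   [main] from either end gives [x y] both colours. In one component, a vertex [z] outside it gets
   different colours from [x] and [y] by [main], against [unif]. *)
have [j [l [ji li jl]]] := ord3_others i.
have [x xW cx] := nbr j; have [y yW cy] := nbr l.
have [xy|nxy] := boolP (C x y); last first.
  have [ne _] := cut _ _ xW yW nxy.
  have e1 : c x y = j by rewrite main ?cx.
  have e2 : c y x = l by rewrite main ?cy // Csym.
  by move: jl; rewrite -e1 -e2 (c_sym ne) eqxx.
have [z zW nxz] : exists2 z, z \in W & ~~ C x z.
  have [xa|] := boolP (C x a); last by exists a.
  exists b => //; apply: contra nab => xb; rewrite Csym in xa; exact: Ctr xa xb.
have nyz : ~~ C y z by apply: contra nxz; exact: Ctr.
by move: jl; rewrite -cx -cy -(main _ z) ?cx // -(main y z) ?cy // (unif x y z) // eqxx.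
Qed.
End Gallai.

(** * Lower bound: links in the hypergraph of colour sets *)

Lemma ord3_sorted (T : finType) (g : T -> 'I_3) (x y z : T) :
  g x != g y -> g y != g z -> g x != g z ->
  exists a b d, [/\ g a = 0%R, g b = 1%R & g d = 2%R] /\
    [set x; y; z] = [set a; b; d].
Proof.
have sw (u v w : T) : [set u; v; w] = [set v; u; w] by rewrite [[set u; v]]setUC.
have sw2 (u v w : T) : [set u; v; w] = [set u; w; v] by rewrite setUAC.
case: (ord3P (g x)) => gx; case: (ord3P (g y)) => gy; case: (ord3P (g z)) => gz;
  rewrite gx gy gz // => _ _ _.
- by exists x, y, z.
- by exists x, z, y; rewrite sw2.
- by exists y, x, z; rewrite sw.
- by exists z, x, y; rewrite sw2 sw.
- by exists y, z, x; rewrite sw sw2.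
- by exists z, y, x; rewrite sw2 sw sw2.
Qed.

(** Each class of [g] contains a connected colour, so the merged 3-colouring is connected, and a
    triangle multicoloured after merging was so before. In hypergraph terms, the colour sets form a
    tight 3-graph. *)
Lemma tight_triangle_sets n k (c : 'I_n -> 'I_n -> 'I_k) (g : 'I_k -> 'I_3) :
  1 < n -> connected_colouring c -> (forall j, exists i, g i = j) ->
  exists a b d, [/\ g a = 0%R, g b = 1%R & g d = 2%R] /\
    [set a; b; d] \in triangle_colour_sets c.
Proof.
move=> n1 [csym cconn] gsurj.
have gc_sym (x y : 'I_n) : x != y -> g (c x y) = g (c y x) by move=> /csym->.
have [|j x y _ _|x [y [z [[xy yz xz] [gab gbd gad]]]]] := gallai gc_sym (V := setT).
- by rewrite cardsT card_ord.
- have [i <-] := gsurj j; apply: connect_sub (cconn i x y) => {}x {}y.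
  case/andP=> xy /eqP <-; apply: connect1.
  by rewrite /mono !inE xy eqxx.
set S := [set c x y; c y z; c x z].
suff SH : S \in triangle_colour_sets c.
  by have [a [b [d [gE SE]]]] := ord3_sorted gab gbd gad; exists a, b, d; rewrite -SE.
rewrite inE; apply/existsP; exists x; apply/existsP; exists y.
apply/existsP; exists z; rewrite xy yz xz eqxx andbT /=.
have ne u v : g u != g v -> u != v by apply: contraNneq => ->.
by rewrite -setUA cardsU1 cards2 !inE negb_or !ne.
Qed.

Lemma link_card n k (c : 'I_n -> 'I_n -> 'I_k) (v : 'I_k) :
  1 < n -> connected_colouring c ->
  k - 2 <= #|[set S in triangle_colour_sets c | v \in S]|.
Proof.
move=> n1 conn; set H := triangle_colour_sets c.
pose E (A : {set 'I_k}) := [set S in H | (v \in S) && (S :\ v \subset A)].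
(* Each new vertex d joined to A in the link of v brings a new edge of the link. *)
have step m : m < k.-1 -> exists A : {set 'I_k},
    [/\ v \notin A, #|A| = m.+1 & m <= #|E A|].
  elim: m => [|m IH] mk.
    have /card_gt0P[a] : 0 < #|~: [set v]| by rewrite cardsC1 card_ord.
    by rewrite !inE => av; exists [set a]; rewrite !inE cards1 eq_sym.
  have [|A [vA cA EA]] := IH; first by lia.
  (* With classes [v], [A] and the rest, the colour set found consists of [v], some [b] in [A] and a
     new colour [d]. *)
  pose g i : 'I_3 := if i == v then 0%R else if i \in A then 1%R else 2%R.
  have [|a [b [d [[ga gb gd] abd]]]] := tight_triangle_sets n1 conn (g := g).
    move=> j.
    case: (ord3P j) => ->.
    - by exists v; rewrite /g eqxx.
    - have /card_gt0P[a aA] : 0 < #|A| by lia.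
      exists a; rewrite /g aA ifN //.
      by apply: contraNneq vA => <-.
    - have /card_gt0P[a] : 0 < #|~: (v |: A)|.
        by rewrite cardsCs setCK cardsU1 vA cA card_ord; lia.
      by rewrite !inE negb_or => /andP[/negPf av /negPf aA]; exists a; rewrite /g av aA.
  have av : a = v.
    by apply: contra_eq ga; rewrite /g => /negPf->; case: ifP.
  have bA : b \in A.
    by apply: contra_eqT gb; rewrite /g => /negPf->; case: ifP.
  have [dv dA] : d != v /\ d \notin A.
    by move: gd; rewrite /g; case: eqP => // _; case: ifP.
  exists (d |: A); split; first by rewrite !inE negb_or eq_sym dv.
    by rewrite cardsU1 dA cA.
  apply: leq_ltn_trans EA _; apply/proper_card/properP; split.
    apply/subsetP => S; rewrite !inE => /and3P[-> -> SA] /=.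
    by rewrite (subset_trans SA) ?subsetUr.
  exists [set a; b; d].
    rewrite inE abd /= av !inE eqxx /=; apply/subsetP => u.
    by rewrite !inE => /andP[/negPf->] /= /orP[/eqP->|->]; rewrite ?bA ?orbT.
  rewrite inE abd /= av !inE eqxx /=; apply/negP => /subsetP/(_ d).
  by rewrite !inE dv eqxx orbT (negPf dA) => /(_ isT).
have [k2|k2] := leqP k 2; first by lia.
(* At this last value [A] has [k - 1] elements: every colour but [v]. *)
have [|A [_ _ EA]] := step (k - 2); first by lia.
apply: leq_trans EA _; apply: subset_leq_card; apply/subsetP => S.
by rewrite !inE => /and3P[-> ->].
Qed.

Lemma triangle_sets_lower n k (c : 'I_n -> 'I_n -> 'I_k) :
  1 < n -> connected_colouring c -> k * (k - 2) <= 3 * #|triangle_colour_sets c|.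
Proof.
move=> n1 conn; set H := triangle_colour_sets c.
have -> : 3 * #|H| = \sum_(S in H) \sum_(v in S) 1.
  rewrite mulnC -sum_nat_const; apply: eq_bigr => S.
  rewrite sum1_card inE => /existsP[x /existsP[y /existsP[z /and5P[_ _ _ /eqP S3 /eqP->]]]].
  by rewrite S3.
rewrite (exchange_big_dep xpredT) //=.
rewrite -{1}(card_ord k) -sum_nat_const; apply: leq_sum => v _.
by rewrite sum1dep_card; apply: link_card.
Qed.

(** * Upper bound: circulant colourings of odd order *)

Section Circulant.
Variables (n k : nat) (col : 'I_n.+2 -> 'I_k).
Hypotheses (n_odd : odd n) (colN : forall d, col (- d)%R = col d).

(** The order is written [n.+2] so that the vertices carry the ring structure of ['Z_n.+2]. *)
Definition circulant (x y : 'I_n.+2) : 'I_k := col (x - y)%R.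

Lemma circulant_connected :
  (forall i, exists2 d, col d = i & coprime n.+2 d) -> connected_colouring circulant.
Proof.
move=> col_unit; split=> [x y _|i x y]; first by rewrite /circulant -colN opprB.
have [d di co_d] := col_unit i.
have Ud : (d : 'Z_n.+2) \is a GRing.unit by rewrite -[d]natr_Zp unitZpE.
have d0 : d != 0%R.
  by apply: contraTneq co_d => ->; rewrite /coprime gcdn0.
have path_d j : connect (colour_rel circulant i) x (x + d *+ j)%R.
  elim: j => [|j IH]; first by rewrite mulr0n addr0.
  apply: connect_trans IH (connect1 _); rewrite /colour_rel /circulant mulrSr addrA.
  set z := (x + d *+ j)%R; rewrite opprD addNKr colN di eqxx andbT.
  by rewrite -subr_eq0 opprD addNKr oppr_eq0.
(* The number of steps of length [d] from [x] to [y], found by inverting the unit [d]. *)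
pose j : 'Z_n.+2 := ((d : 'Z_n.+2)^-1 * (y - x))%R.
have -> : y = (x + d *+ j)%R.
  have -> : (d *+ j)%R = (d * j :> 'Z_n.+2)%R.
    by rewrite -mulr_natr natr_Zp.
  by rewrite /j mulVKr // addrC subrK.
exact: path_d.
Qed.

Lemma odd_order_opp_neq (d : 'I_n.+2) : d != 0%R -> d != (- d)%R.
Proof.
move=> d0; apply: contraNneq d0 => dN; apply/eqP/val_inj => /=.
have := congr1 val dN; rewrite /= => dE.
have dn := ltn_ord d.
have [//|d1] := posnP d.
move: dE; rewrite modn_small; lia.
Qed.

Lemma circulant_card : 12 * #|triangle_colour_sets circulant| <= n.+2 ^ 2.
Proof.
set H := triangle_colour_sets _.
(* The differences along a triangle, oriented cyclically, sum to zero, so two of them determine the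
   third. The fibres of [F] are disjoint, and each colour set has a fibre of at least 12 pairs. *)
pose F (p : 'I_n.+2 * 'I_n.+2) := [set col p.1; col p.2; col (- (p.1 + p.2))%R].
have -> : n.+2 ^ 2 = #|{: 'I_n.+2 * 'I_n.+2}| by rewrite card_prod !card_ord mulnn.
apply: (@leq_trans (\sum_(S in H) #|[set p | F p == S]|)); last first.
  rewrite -sum1_card (partition_big F xpredT) //= [leqRHS](bigID (mem H)) /=.
  apply: leq_trans (leq_addr _ _); apply: eq_leq; apply: eq_bigr => S _.
  by rewrite sum1dep_card.
rewrite mulnC -sum_nat_const; apply: leq_sum => S.
rewrite inE => /existsP[x /existsP[y /existsP[z]]]; rewrite /circulant.
have -> : col (x - z)%R = col (- ((x - y) + (y - z)))%R by rewrite addrA subrK colN.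
move=> /and5P[xy yz xz + /eqP SE].
have : (x - y != 0)%R by rewrite subr_eq0.
have : (y - z != 0)%R by rewrite subr_eq0.
have : (- (x - y + (y - z)) != 0)%R by rewrite addrA subrK oppr_eq0 subr_eq0.
have : ((x - y) + (y - z) + - (x - y + (y - z)) = 0)%R by rewrite subrr.
move: (x - y)%R (y - z)%R (- (x - y + (y - z)))%R SE => {xy yz xz} d e m SE dem m0 e0 d0.
have sw (u v w : 'I_k) : [set u; v; w] = [set v; u; w] by rewrite [[set u; v]]setUC.
have sw2 (u v w : 'I_k) : [set u; v; w] = [set u; w; v] by rewrite setUAC.
have FE u v w : (u + v + w = 0)%R ->
    F (u, v) = [set col u; col v; col w] /\ F (- u, - v)%R = [set col u; col v; col w].
  move/eqP; rewrite addr_eq0 => /eqP uv; rewrite /F /= -opprD opprK uv opprK !colN.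
  by split.
rewrite -setUA cardsU1 cards2 !inE negb_or.
case: (eqVneq (col d) (col e)) (eqVneq (col d) (col m)) (eqVneq (col e) (col m)) =>
  [_|de] [_|dm] [_|em] //= _.
have opp (u : 'I_n.+2) : u != 0%R -> (u == - u)%R = false /\ (- u == u)%R = false.
  by move=> /odd_order_opp_neq uN; rewrite [(- u)%R == u]eq_sym (negPf uN).
have ne (u v : 'I_n.+2) : col u != col v -> [/\ u == v = false, v == u = false,
    (u == - v)%R = false, (- v == u)%R = false &
    [/\ (- u == v)%R = false, (v == - u)%R = false,
    (- u == - v)%R = false & (- v == - u)%R = false]].
  move=> /eqP uv; split; [..|split]; apply/eqP => /(congr1 col);
    rewrite ?colN => E; congruence.
(* Distinct colours separate [d], [e], [m] even up to sign; odd order separates each from its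
   negative. *)
pose l : seq ('I_n.+2 * 'I_n.+2) :=
  [:: (d, e); (- d, - e); (e, d); (- e, - d); (d, m); (- d, - m); (m, d); (- m, - d);
      (e, m); (- e, - m); (m, e); (- m, - e)]%R.
have ul : uniq l.
  have [] := ne _ _ de; have [] := ne _ _ dm; have [] := ne _ _ em.
  rewrite /= !inE !xpair_eqE => -> -> -> -> [-> -> -> ->] -> -> -> -> [-> -> -> ->].
  move=> -> -> -> -> [-> -> -> ->].
  have [-> ->] := opp _ d0; have [-> ->] := opp _ e0; have [-> ->] := opp _ m0.
  by rewrite ?eqxx ?andbF.
rewrite -[12]/(size l) cardE; apply: uniq_leq_size => //.
apply/allP; rewrite /l /= !mem_enum !inE SE.
have [-> ->] := FE _ _ _ dem.
have [|-> ->] := FE e d m; first by rewrite [(e + d)%R]addrC.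
have [|-> ->] := FE d m e; first by rewrite addrAC.
have [|-> ->] := FE m d e; first by rewrite -addrA addrC.
have [|-> ->] := FE e m d; first by rewrite addrC addrA.
have [|-> ->] := FE m e d; first by rewrite addrC [(m + e)%R]addrC addrA.
rewrite (sw (col e) (col d)) (sw2 (col d) (col m)) (sw (col m) (col d)).
rewrite (sw2 (col d) (col m)) (sw2 (col e) (col m)) (sw (col e) (col d)).
by rewrite (sw (col m) (col e)) (sw2 (col e) (col m)) (sw (col e) (col d)) !eqxx.
Qed.
End Circulant.

(** The units of ['Z_n.+2] up to sign are listed by their representatives in the lower half, and
    each of the first [k] generates its own colour. *)
Lemma circulant_achievable n k :
  odd n -> 0 < k -> k <= count (coprime n.+2) (iota 0 n./2.+2) ->
  exists2 m, achievable k m & 12 * m <= n.+2 ^ 2.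
Proof.
move=> n_odd; case: k => // k _; rewrite -size_filter.
set L := filter _ _ => kL.
pose rep (d : 'I_n.+2) := minn d (n.+2 - d).
(* Non-units and surplus units may have an index out of range; [inord] then sends them to colour 0,
   which only gains edges. *)
pose col d : 'I_k.+1 := inord (index (rep d) L).
have colN d : col (- d)%R = col d.
  congr (inord (index _ _)); rewrite /rep /=.
  have dn := ltn_ord d; have [->|d0] := posnP d; first by rewrite subn0 modnn; lia.
  by rewrite modn_small; lia.
exists #|triangle_colour_sets (circulant col)|; last exact: circulant_card.
exists n.+2, (circulant col); split=> //; split=> //.
apply: circulant_connected => // i.
have iL : i < size L by apply: leq_trans kL; exact: ltn_ord.
have := mem_nth 0 iL; rewrite mem_filter mem_iota /= => /andP[co rn].
have dE : (inord (nth 0 L i) : 'I_n.+2) = nth 0 L i :> nat by rewrite inordK //; lia.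
exists (inord (nth 0 L i)); last by rewrite dE.
rewrite /col /rep dE (_ : minn _ _ = nth 0 L i); last by lia.
rewrite index_uniq ?filter_uniq ?iota_uniq //; exact: inord_val.
Qed.

(** * Counting units, and multiplicative density of the products of two prime powers *)

Lemma count_dvd_iota p h : 0 < p -> count (dvdn p) (iota 0 h.+1) = (h %/ p).+1.
Proof.
move=> p0; elim: h => [|h IH]; first by rewrite /= dvdn0 div0n.
by rewrite -[in LHS]addn1 iotaD count_cat IH /= addn0 divnS // addnC addnS.
Qed.

(** Union bound over the multiples of [p] and of [q]; the successors count the multiple 0. *)
Lemma count_coprime_lower N p q h : 0 < p -> 0 < q ->
  (forall r, ~~ (p %| r) -> ~~ (q %| r) -> coprime N r) ->
  h.+1 <= count (coprime N) (iota 0 h.+1) + (h %/ p).+1 + (h %/ q).+1.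
Proof.
move=> p0 q0 co; rewrite -!count_dvd_iota //.
rewrite -[leqLHS](size_iota 0) -(count_predC (coprime N)) -addnA leq_add2l.
rewrite -count_predUI; apply: leq_trans (leq_addr _ _).
apply: sub_count => r /=; apply: contraR; rewrite negb_or => /andP[]; exact: co.
Qed.

(** Supplies two distinct powers with ratio close to 1; exchanging one for the other is the fine
    step used in [power_products_dense]. *)
Lemma close_prime_powers p q t : prime p -> prime q -> p != q -> 0 < t ->
  exists d e, [/\ p ^ d != q ^ e, t * p ^ d <= t.+1 * q ^ e & t * q ^ e <= t.+1 * p ^ d]
    /\ 0 < d.
Proof.
move=> pp pq npq t0.
pose j i := trunc_log q (p ^ i).
(* Pigeonhole: two of the ratios p ^ i / q ^ j i, all in [1, q[, have the same
   integer part after scaling by t. *)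
pose cell i := t * p ^ i %/ q ^ j i.
have q1 := prime_gt1 pq; have p0 := prime_gt0 pp.
have jP i : q ^ j i <= p ^ i < q ^ (j i).+1 by apply: trunc_log_bounds; rewrite ?expn_gt0 ?p0.
have qj0 i : 0 < q ^ j i by rewrite expn_gt0 prime_gt0.
have cellP i : cell i < t * q.
  by rewrite ltn_divLR // -mulnA -expnS ltn_pmul2l //; case/andP: (jP i).
have : ~ injective (fun i : 'I_(t * q).+1 => Ordinal (cellP i)).
  by move/leq_card; rewrite !card_ord ltnn.
move=> /injectiveP/injectivePn[a [b ab /(congr1 val) /= cab]].
wlog lt_ab : a b ab cab / a < b.
  move=> W; case: (ltngtP a b) => [||/val_inj E]; first exact: W.
    by apply: W; rewrite // eq_sym.
  by rewrite E eqxx in ab.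
have le_j : j a <= j b.
  by apply: leq_trunc_log; rewrite leq_pexp2l // ltnW.
exists (b - a), (j b - j a); split; last by rewrite subn_gt0.
have d0 : 0 < b - a by rewrite subn_gt0.
have ne : p ^ (b - a) != q ^ (j b - j a).
  apply: contraNneq npq => E.
  have : p %| q ^ (j b - j a) by rewrite -E dvdn_exp.
  by rewrite Euclid_dvdX // dvdn_prime2 // => /andP[].
(* Two ratios in the common cell [m] differ by a factor below [(m + 1) / m], which is at most
   [(t + 1) / t] because [m >= t]. *)
have ta : t <= cell a by rewrite leq_divRL // leq_pmul2l //; case/andP: (jP a).
have := leq_divM (t * p ^ a) (q ^ j a); have := ltn_ceil (t * p ^ a) (qj0 a).
have := leq_divM (t * p ^ b) (q ^ j b); have := ltn_ceil (t * p ^ b) (qj0 b).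
have pE : p ^ b = p ^ a * p ^ (b - a) by rewrite -expnD subnKC // ltnW.
have qE : q ^ j b = q ^ j a * q ^ (j b - j a) by rewrite -expnD subnKC.
rewrite -/(cell a) -/(cell b) -cab pE qE.
have := qj0 a; have : 0 < p ^ a by rewrite expn_gt0 p0.
move: (p ^ a) (p ^ (b - a)) (q ^ j a) (q ^ (j b - j a)) (cell a) ta ne.
move=> A P C Q m tm ne A0 C0 h1 h2 h3 h4.
have mPQ : m * P < m.+1 * Q.
  rewrite -(ltn_pmul2l C0); apply: leq_ltn_trans (_ : t * (A * P) < _); last by lia.
  by rewrite mulnCA mulnA mulnA leq_mul2r h4 orbT.
have mQP : m * Q < m.+1 * P.
  rewrite -(ltn_pmul2l C0); apply: leq_ltn_trans (_ : t * (A * P) < _); first by lia.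
  have P0 : 0 < P by nia.
  by rewrite [C * _]mulnCA !mulnA ltn_pmul2r.
by split=> //; nia.
Qed.

(** Start from the largest [u ^ n] not above [x] and turn factors [u] into [v] one by one. Each
    exchange costs a factor of at most [(t + 1) / t], so the first product to reach [x] overshoots
    by no more than that. *)
Lemma power_products_dense u v t : 1 < u < v -> 0 < t -> t * v <= t.+1 * u ->
  exists X, forall x, X <= x -> exists a b,
    x <= u ^ a * v ^ b /\ t * (u ^ a * v ^ b) <= t.+1 * x.
Proof.
case/andP=> u1 uv t0 tuv.
(* Bernoulli's inequality for (1 + 1/u) ^ n. *)
have bern n : u ^ n * (u + n) <= v ^ n * u.
  elim: n => [|n IH]; first by rewrite addn0.
  apply: leq_trans (_ : (u ^ n * (u + n)) * u.+1 <= _).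
    rewrite expnS -mulnA mulnCA -mulnA leq_mul2l; apply/orP; right; nia.
  by rewrite [v ^ _]expnSr [v ^ n * v * u]mulnAC; apply: leq_mul.
have big n : u ^ 2 <= n -> u ^ n.+1 <= v ^ n.
  move=> un; rewrite -(leq_pmul2r (ltnW u1)); apply: leq_trans (bern n).
  by rewrite expnSr -mulnA leq_mul2l mulnn (leq_trans un) ?orbT ?leq_addl.
(* Forces [n >= u ^ 2], so that by [big] exchanging all [n] factors passes [x]. *)
exists (u ^ (u ^ 2)) => x Xx.
have x0 : 0 < x by apply: leq_trans Xx; rewrite expn_gt0 ltnW.
pose n := trunc_log u x.
have /andP[unx xun] : u ^ n <= x < u ^ n.+1 by apply: trunc_log_bounds.
have nu : u ^ 2 <= n.
  exact: trunc_log_max.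
have ex : exists b, x <= u ^ (n - b) * v ^ b.
  by exists n; rewrite subnn mul1n (leq_trans (ltnW xun)) ?big.
case: (ex_minnP ex) => b xb bmin; have bn : b <= n.
  by apply: bmin; rewrite subnn mul1n (leq_trans (ltnW xun)) ?big.
exists (n - b), b; split=> //.
case: b xb bmin bn => [|b] xb bmin bn.
  by rewrite subn0 muln1 leq_mul.
have lt_x : u ^ (n - b) * v ^ b < x.
  by rewrite ltnNge; apply/negP => /bmin; rewrite ltnn.
rewrite expnS [u ^ _ * _]mulnCA mulnA.
apply: leq_trans (leq_mul tuv (leqnn _)) _.
rewrite -mulnA leq_mul2l /= mulnA -expnS -subSn // subSS.
exact: ltnW.
Qed.

Lemma prime_powers_dense p q t : prime p -> prime q -> p != q -> 1 < t ->
  exists X, forall x, X <= x -> exists a b,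
    x <= p ^ a * q ^ b /\ t * (p ^ a * q ^ b) <= t.+1 * x.
Proof.
move=> pp pq npq t1; have t0 := ltnW t1.
have [d [e [[ne le_pq le_qp] d0]]] := close_prime_powers pp pq npq t0.
have pd1 : 1 < p ^ d by rewrite -(exp1n d) ltn_exp2r // prime_gt1.
have [lt_pq|lt_qp|E] := ltngtP (p ^ d) (q ^ e); last by rewrite E eqxx in ne.
- have [|X HX] := @power_products_dense (p ^ d) (q ^ e) t _ t0 le_qp.
    by rewrite pd1 lt_pq.
  exists X => x /HX[a [b ab]]; exists (d * a), (e * b); by rewrite !expnM.
- have [|X HX] := @power_products_dense (q ^ e) (p ^ d) t _ t0 le_pq.
    rewrite lt_qp andbT ltn_neqAle expn_gt0 (prime_gt0 pq) andbT eq_sym.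
    (* If [q ^ e] were 1, then [t * p ^ d <= t + 1], impossible for [t] and [p ^ d] at least 2. *)
    by apply: contraTneq le_pq => ->; rewrite -ltnNge; nia.
  exists X => x /HX[a [b ab]]; exists (d * b), (e * a); by rewrite !expnM mulnC.
Qed.

(** * Choice of the parameters and the asymptotics of [f] *)

Lemma f_min k m : achievable k m -> f k <= m.
Proof.
rewrite /f => /achievableP ach; case: excluded_middle_informative => [ex|[]].
  by case: ex_minnP => r _; apply.
by exists m.
Qed.

(** An achievable value rules out the default 0 of [f]. *)
Lemma f_achievable k m : achievable k m -> achievable k (f k).
Proof.
rewrite /f => /achievableP ach; case: excluded_middle_informative => [ex|[]].
  by case: ex_minnP => r /achievableP.
by exists m.
Qed.

(** Here [C] counts units, [2 * z] bounds the loss and [s] is a reserve of about [k / t]. If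
    [C < k], then [s < 2 * z], hence [k < 2 * t * z], and [8 * t * z <= h + 1 <= k + 2 * z < 3 * t *
    z + 1] is absurd. *)
Lemma count_threshold t k s h C z :
  1 < t -> k < s.+1 * t -> k + s <= h -> z * (8 * t) <= h.+1 -> h <= C + 2 * z -> k <= C.
Proof.
move=> t1 ks hk hz hC; rewrite leqNgt; apply/negP => Ck.
have sz : t * s.+1 <= t * (2 * z) by rewrite leq_mul //; lia.
have tz : 2 * z <= t * z by rewrite leq_mul2r t1 orbT.
lia.
Qed.

(** Both [s] and [t + 1] are at most [k / t], so the excess of [N] over [2 * k] is of relative order
    [1 / t]; the 4 is a round bound. *)
Lemma order_bound t k s N :
  0 < t -> t * t.+1 <= k -> s * t <= k -> t * N <= t.+1 * (2 * k + 2 * s + 2) ->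
  t * N <= 2 * k * (t + 4).
Proof.
move=> t0 ktt sk tN.
rewrite -(leq_pmul2l t0); apply: leq_trans (leq_mul (leqnn t) tN) _.
have tst : t * (s * t) <= t * k by rewrite leq_mul2l sk orbT.
have tk : 1 * k <= t * k by rewrite leq_mul2r t0 orbT.
lia.
Qed.

Lemma triples_bound t k N m :
  0 < t -> t * N <= 2 * k * (t + 4) -> 12 * m <= N ^ 2 -> 3 * m * t <= k ^ 2 * (t + 24).
Proof.
move=> t0 tN m12; rewrite -(leq_pmul2l t0).
have : t ^ 2 * (12 * m) <= (2 * k * (t + 4)) ^ 2.
  apply: leq_trans (_ : (t * N) ^ 2 <= _); last by rewrite leq_exp2r.
  by rewrite expnMn leq_mul2l m12 orbT.
(* The 24 absorbs [8 * t + 16]. *)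
have t4 : (t + 4) ^ 2 <= t * (t + 24) by rewrite -mulnn; lia.
have : k ^ 2 * (t + 4) ^ 2 <= k ^ 2 * (t * (t + 24)) by rewrite leq_mul2l t4 orbT.
rewrite !expnMn -[t ^ 2]mulnn; move: (k ^ 2) ((t + 4) ^ 2) => K T; lia.
Qed.

Lemma achievable_upper t : 1 < t -> exists K, forall k, K <= k ->
  exists2 m, achievable k m & 3 * m * t <= k ^ 2 * (t + 24).
Proof.
move=> t1; have t0 := ltnW t1.
(* Primes above [8 * t] make the multiples of [p] or [q] fewer than the reserve [s] can cover. *)
have [p p_gt pp] := prime_above (8 * t); have [q q_gt pq] := prime_above p.
have [X HX] := prime_powers_dense pp pq (negbT (ltn_eqF q_gt)) t1.
exists (X + t * t.+1) => k kK.
have ktt : t * t.+1 <= k by apply: leq_trans kK; exact: leq_addl.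
have k0 : 0 < k by apply: leq_trans ktt; rewrite muln_gt0 t0.
have [s sk ks] : exists2 s, s * t <= k & k < s.+1 * t.
  by exists (k %/ t); rewrite ?leq_divM ?ltn_ceil.
(* An order this large has at least [k + s] nonzero differences up to sign. *)
have [|a [b []]] := HX (2 * k + 2 * s + 2).
  by apply: leq_trans (leq_addr (t * t.+1) _) (leq_trans kK _); lia.
have N_odd : odd (p ^ a * q ^ b).
  have odd_gt2 r : prime r -> 2 < r -> odd r.
    by move=> pr; case: (even_prime pr) => [->|].
  have p2 : 2 < p by apply: leq_ltn_trans p_gt; lia.
  by rewrite oddM !oddX !odd_gt2 ?orbT // (ltn_trans p2).
have N_coprime r : ~~ (p %| r) -> ~~ (q %| r) -> coprime (p ^ a * q ^ b) r.
  by move=> pr qr; rewrite coprimeMl !coprimeXl // prime_coprime.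
move: (p ^ a * q ^ b) N_odd N_coprime => [|[|n]] N_odd N_coprime Nx tN; try lia.
have n_odd : odd n by rewrite /= negbK in N_odd.
have [|m ach m12] := @circulant_achievable n k n_odd k0; last first.
  exists m => //; apply: (triples_bound t0 _ m12).
  exact: order_bound tN.
have hk : k + s <= n./2.
  have nE : n = n./2.*2.+1 by rewrite -[LHS]odd_double_half n_odd.
  by move: n./2 nE Nx => h ->; clear; lia.
have := count_coprime_lower n./2.+1 (prime_gt0 pp) (prime_gt0 pq) N_coprime.
have hp : n./2.+1 %/ p <= n./2.+1 %/ (8 * t) by rewrite leq_div2l ?muln_gt0 // ltnW.
have hq : n./2.+1 %/ q <= n./2.+1 %/ (8 * t).
  by rewrite leq_div2l ?muln_gt0 // ltnW // (ltn_trans p_gt).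
move=> cnt; apply: (count_threshold t1 ks hk (leq_divM _ _)).
by move: (count _ _) (_ %/ p) (_ %/ q) (_ %/ (8 * t)) cnt hp hq; clear; lia.
Qed.

Local Open Scope ring_scope.

(* f(k) = (k^2/3)(1 + o(1)) as k -> oo, i.e. 3 f(k) / k^2 -> 1 *)
Theorem theorem7 :
  forall eps : rat, 0 < eps ->
  exists K : nat, forall k : nat, (K <= k)%N ->
    `| 3 * (f k)%:R / (k ^ 2)%:R - 1 | < eps.
Proof.
move=> eps eps0.
(* The upper bound has relative error [24 / t]. *)
have [t t1 t_eps] : exists2 t : nat, (1 < t)%N & 24 < eps * t%:R.
  have : eps^-1 < (Num.bound eps^-1)%:R by rewrite archi_boundP ?invr_ge0 ?ltW.
  rewrite -(ltr_pM2l eps0) mulfV ?gt_eqF // => lt_b.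
  exists (24 * Num.bound eps^-1 + 2)%N; first by rewrite addn2.
  rewrite natrD natrM; move: (_%:R) lt_b => b; lra.
have [K HK] := achievable_upper t1.
(* With [k >= t], the relative error [2 / k] of the lower bound is below [eps] too. *)
exists (maxn K t) => k; rewrite geq_max => /andP[/HK[m ach m_le] tk].
have k0 : (0 < k)%N by apply: leq_trans tk; exact: ltnW.
have [n [c [n2 [conn fE]]]] := f_achievable ach.
have lower : (k * (k - 2) <= 3 * f k)%N by rewrite -fE; exact: triangle_sets_lower.
have upper : (3 * f k * t <= k ^ 2 * (t + 24))%N.
  by apply: leq_trans m_le; rewrite leq_mul2r leq_mul2l f_min ?orbT.
have k20 : 0 < (k ^ 2)%:R :> rat by rewrite ltr0n expn_gt0 k0.
have kE : (k ^ 2)%:R = k%:R ^+ 2 :> rat by rewrite natrX.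
have lowerR : k%:R ^+ 2 - 2 * k%:R <= 3 * (f k)%:R :> rat.
  rewrite -natrX -natrM lerBlDr -!natrM -natrD ler_nat -mulnn.
  by move: lower; rewrite mulnBr; lia.
have upperR : 3 * (f k)%:R * t%:R <= k%:R ^+ 2 * (t%:R + 24) :> rat.
  rewrite -kE; move: (k ^ 2)%N upper => k2.
  by rewrite -(ler_nat rat) !natrM natrD.
rewrite kE in k20 *.
have kR : 0 < k%:R :> rat by rewrite ltr0n.
have tR : 0 < t%:R :> rat by rewrite ltr0n ltnW.
have tkR : t%:R <= k%:R :> rat by rewrite ler_nat.
rewrite ltr_norml; apply/andP; split.
  rewrite ltrBrDr ltr_pdivlMr //; apply: lt_le_trans lowerR.
  have : 24 < eps * k%:R by apply: lt_le_trans t_eps _; rewrite ler_pM2l.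
  nra.
rewrite ltrBlDr ltr_pdivrMr // -(ltr_pM2r tR); apply: le_lt_trans upperR _.
nra.
Qed.
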